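(* Let $(\sigma',\alpha'),(\sigma,\alpha)\in Z_k\times W_k$. Then $Z(\sigma',\alpha')\subseteq Z(\sigma,\alpha)$ if and only if there exists $\tau\in W$ such that $\tau\prec\sigma\alpha$ with respect to the ordinary Bruhat order on $W$ and $\sigma'\alpha'W(C_k)=\tau W(C_k)$ in $W/W(C_k)$.
   Context: $K$ is an algebraically closed field of characteristic zero; $G=\mathrm{GL}_n(K)$, $B\subseteq G$ the upper-triangular Borel subgroup, $W=S_n$, $s_i=(i\ i+1)$, $l$ the Bruhat (Coxeter) length and $\prec$ the usual (reflexive) Bruhat order on $W$; $\dot w$ is the permutation matrix of $w\in W$, $\dot we_i=e_{w(i)}$ for a fixed basis $(e_1,\dots,e_n)$ of $K^n$. Fix $k$ with $0\le 2k\le n$. Let $x_k\in\mathfrak{gl}_n$ be given by $x_k(e_i)=0$ for $i\le n-k$ and $x_k(e_i)=e_{i-(n-k)}$ for $i>n-k$; $\mathbb{O}_k=\{u\in\mathfrak{gl}_n\mid u^2=0,\ \mathrm{rk}(u)=k\}=G.x_k$ (conjugation), $C_k=\mathrm{Stab}_G(x_k)$, $G/C_k\simeq\mathbb{O}_k$ via $gC_k\mapsto gx_kg^{-1}$. $W_k=\langle s_1,\dots,s_{k-1}\rangle$; $Z_k=\{\sigma\in W\mid l(\sigma s_i)=l(\sigma)+1\text{ for all } i\in\{1,\dots,n-1\}\setminus\{k,n-k\}\}$. $W(L)=\langle s_i\mid i\notin\{k,n-k\}\rangle$, and $W(C_k)\subseteq W(L)$ is the Weyl group of the reductive part of $C_k$,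 i.e. the subgroup of those $w\in W(L)$ with $w(n-k+i)=n-k+w(i)$ for $i=1,\dots,k$. For $(\sigma,\alpha)\in Z_k\times W_k$, $Z(\sigma,\alpha)$ is the closure in $\mathbb{O}_k$ of the $B$-orbit $\mathcal{C}(\sigma,\alpha)=B\dot\sigma\dot\alpha C_k/C_k$. *)

(* Defs.v *)
From mathcomp Require Import all_boot all_order all_fingroup all_algebra.
From mathcomp Require Import mpoly.

Set Implicit Arguments.
Unset Strict Implicit.
Unset Printing Implicit Defensive.

Import GRing.Theory.
Local Open Scope ring_scope.

(* Throughout, 'I_n = {0, ..., n-1}: the mathematical index i in {1, ..., n}
   is the ordinal of value i - 1.                                             *)

(* The product of the group 'S_n of MathComp is diagrammatic:
   (s * t) i = t (s i).  The product st of W = S_n is ordinary composition,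
   (st)(i) = s(t(i)).                                                         *)
Definition pcomp (n : nat) (s t : 'S_n) : 'S_n := (t * s)%g.

Notation "s \oS t" := (pcomp s t) (at level 40, left associativity).

Lemma pcompE (n : nat) (s t : 'S_n) (i : 'I_n) : (s \oS t) i = s (t i).
Proof. by rewrite /pcomp permM. Qed.

Definition pcoset (n : nat) (s : 'S_n) (H : {set 'S_n}) : {set 'S_n} :=
  [set s \oS c | c in H].

Lemma ord_next_proof (n : nat) (i : 'I_n.-1) : (i.+1 < n)%N.
Proof. by rewrite -ltn_predRL. Qed.

(* For i : 'I_n.-1, [simple i] is the Coxeter generator s_{i+1}: it exchanges
   the ordinals of values i and i+1, that is, the indices i+1 and i+2.        *)
Definition simple (n : nat) (i : 'I_n.-1) : 'S_n :=
  tperm (widen_ord (leq_pred n) i) (Ordinal (ord_next_proof i)).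

(* Reversing a word does not change its size, so it is immaterial here that
   \prod is the diagrammatic product.                                         *)
Definition has_word (n : nat) (w : 'S_n) (m : nat) : bool :=
  [exists t : m.-tuple 'I_n.-1, w == (\prod_(i <- t) simple i)%g].

Lemma tperm_gen_simple (n : nat) (a b : 'I_n) :
  tperm a b \in <<[set simple i | i : 'I_n.-1]>>%g.
Proof.
wlog ltab : a b / (a < b)%N.
  move=> H; case: (ltngtP a b) => [|ltba|/val_inj ->]; first exact: H.
    by rewrite tpermC; apply: H.
  by rewrite tperm1 group1.
have [d] : exists d, (b = a + d.+1 :> nat)%N.
  by exists (b - a.+1)%N; rewrite addnS -addSn subnKC.
elim: d b ltab => [|d IHd] b ltab eb.
  have lta : (a < n.-1)%N by rewrite ltn_predRL -[a.+1]addn1 -eb.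
  suff -> : tperm a b = simple (Ordinal lta) by apply/mem_gen/imset_f.
  by rewrite /simple; congr tperm; apply: val_inj; rewrite //= eb addn1.
have ltc : (a + d.+1 < n.-1)%N by rewrite ltn_predRL -addnS -eb.
have ltc' : (a + d.+1 < n)%N by apply: leq_trans (leq_pred n).
have IHc : tperm a (Ordinal ltc') \in <<[set simple i | i : 'I_n.-1]>>%g.
  by apply: IHd => //=; rewrite addnS ltnS leq_addr.
have Hs : simple (Ordinal ltc) \in <<[set simple i | i : 'I_n.-1]>>%g.
  by apply/mem_gen/imset_f.
suff -> : tperm a b = (tperm a (Ordinal ltc') ^ simple (Ordinal ltc))%g.
  by rewrite groupJ.
have ec : widen_ord (leq_pred n) (Ordinal ltc) = Ordinal ltc' by apply: val_inj.
have eb' : Ordinal (ord_next_proof (Ordinal ltc)) = b.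
  by apply: val_inj; rewrite /= eb -addnS.
rewrite tpermJ /simple ec eb' tpermL tpermD //.
  by rewrite -val_eqE /= neq_ltn addnS ltnS leq_addr orbT.
by rewrite neq_ltn ltab orbT.
Qed.

Lemma has_word_ex (n : nat) (w : 'S_n) : exists m, has_word w m.
Proof.
have : w \in <<[set simple i | i : 'I_n.-1]>>%g.
  case: (prod_tpermP w) => ts -> _.
  by apply: group_prod => t _; apply: tperm_gen_simple.
case/gen_prodgP => m [c Hc ->].
have /fin_all_exists [f Hf] : forall j, exists i, c j = simple i.
  by move=> j; have /imsetP[i _ ->] := Hc j; exists i.
exists m; apply/existsP; exists [tuple f j | j < m]; apply/eqP.
by rewrite big_tuple; apply: eq_bigr => j _; rewrite tnth_mktuple.
Qed.

Definition cox_length (n : nat) (w : 'S_n) : nat := ex_minn (has_word_ex w).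

Definition bruhat_step (n : nat) (u w : 'S_n) : bool :=
  [exists a : 'I_n, [exists b : 'I_n,
    (w == u \oS tperm a b) && (cox_length u < cox_length w)%N]].

(* The reflexive Bruhat order: [connect] is reflexive-transitive closure. *)
Definition bruhat (n : nat) (u w : 'S_n) : bool := connect (@bruhat_step n) u w.

Definition Wk (n k : nat) : {set 'S_n} :=
  <<[set simple i | i : 'I_n.-1 & (i.+1 < k)%N]>>%g.

Definition Zk (n k : nat) : {set 'S_n} :=
  [set s : 'S_n | [forall i : 'I_n.-1,
     (i.+1 != k) && (i.+1 != n - k)%N ==>
     (cox_length (s \oS simple i) == (cox_length s).+1)]].

Definition WL (n k : nat) : {set 'S_n} :=
  <<[set simple i | i : 'I_n.-1 & (i.+1 != k) && (i.+1 != n - k)%N]>>%g.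

Definition WC (n k : nat) : {set 'S_n} :=
  [set w in WL n k | [forall i : 'I_n, [forall j : 'I_n,
     (i < k)%N && (j == n - k + i :> nat)%N ==>
     (w j == n - k + w i :> nat)%N]]].

Section Geometry.
Variables (K : fieldType) (n : nat).

(* Matrices act on column vectors: column j of u is u(e_j). *)
Definition wdot (w : 'S_n) : 'M[K]_n := \matrix_(i, j) (i == w j)%:R.

Definition xk (k : nat) : 'M[K]_n :=
  \matrix_(i, j) ((n - k <= j)%N && (i == j - (n - k) :> nat)%N)%:R.

Definition Ok (k : nat) (u : 'M[K]_n) : Prop := u *m u = 0 /\ \rank u = k.

Definition conjmx_by (g u : 'M[K]_n) : 'M[K]_n := g *m u *m invmx g.

Definition Borel (b : 'M[K]_n) : Prop :=
  b \in unitmx /\ forall i j : 'I_n, (j < i)%N -> b i j = 0.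

Definition Ck (k : nat) (c : 'M[K]_n) : Prop :=
  c \in unitmx /\ conjmx_by c (xk k) = xk k.

(* The orbit B s a C_k / C_k, seen inside O_k through g C_k |-> g x_k g^-1. *)
Definition Borbit (k : nat) (s a : 'S_n) (u : 'M[K]_n) : Prop :=
  exists b c : 'M[K]_n, [/\ Borel b, Ck k c &
    u = conjmx_by (b *m wdot s *m wdot a *m c) (xk k)].

(* Polynomial functions in the n * n entries of a matrix. *)
Definition mxeval (p : {mpoly K[n * n]}) (u : 'M[K]_n) : K :=
  p.@[fun i => mxvec u ord0 i].

Definition zariski_closed (F : 'M[K]_n -> Prop) : Prop :=
  exists I : {mpoly K[n * n]} -> Prop,
    forall u, F u <-> (forall p, I p -> mxeval p u = 0).

(* Closure of S in the subspace Y. *)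
Definition closure_in (Y S : 'M[K]_n -> Prop) (u : 'M[K]_n) : Prop :=
  Y u /\ forall F, zariski_closed F -> (forall v, S v -> F v) -> F u.

Definition Zclosure (k : nat) (s a : 'S_n) : 'M[K]_n -> Prop :=
  closure_in (Ok k) (Borbit k s a).

End Geometry.

(* Main.v *)
Require Import Defs.
From mathcomp Require Import all_boot all_order all_fingroup all_algebra.
From mathcomp Require Import mpoly zify.

(* Write w = sigma alpha and N_w = w x_k w^-1, a sum of k elementary matrices:
   the arcs w(n-k+m) -> w(m).  As w is increasing on the last block,
   B w B . x_k = B . N_w.

   If tau < tau t_ab, the curve tau (1 + s E_ba) lies in B tau t_ab B for s <> 0
   and passes through tau at s = 0; hence the orbit of N_tau is in the closure
   of that of N_w as soon as tau <= w.

   Conversely, the ranks of the lower left submatrices are constant on B-orbits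
   and can only drop in the closure.  At N_w such a rank counts the arcs with
   source < i and target >= j.  If the counts for w' are bounded by those for w,
   the arcs of w' can be reordered greedily, which means multiplying w' by some
   v in W(C_k), so that w' v satisfies the tableau criterion for w' v <= w. *)

Set Implicit Arguments.
Unset Strict Implicit.
Unset Printing Implicit Defensive.

(** * Length and Bruhat order *)

Section Inversions.
Variable n : nat.
Implicit Types (u w : 'S_n) (a b : 'I_n).

Definition inversions w : {set 'I_n * 'I_n} :=
  [set p : 'I_n * 'I_n | (p.1 < p.2) && (w p.2 < w p.1)].

(** A pair moves with the transposition only when its order is respected. This makes the map an
    involution, hence injective, and it still compares the inversions of $u$ with those of $u
    t_{ab}$. *)
Definition swap_pair a b (p : 'I_n * 'I_n) :=
  if (p.1 < p.2) == (tperm a b p.1 < tperm a b p.2) then (tperm a b p.1, tperm a b p.2) else p.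

Lemma swap_pairK a b : involutive (swap_pair a b).
Proof.
case=> i j; rewrite {2}/swap_pair /=; case: ifP => h; last by rewrite /swap_pair h.
by rewrite /swap_pair /= !tpermK eq_sym h.
Qed.

Lemma swap_pair_inversions u a b : a < b -> u a < u b ->
  swap_pair a b @: inversions u \subset inversions (u \oS tperm a b) :\ (a, b).
Proof.
move=> ab uab; apply/subsetP => _ /imsetP[[i j] + ->].
rewrite !inE /swap_pair /= => /andP[ij uij]; rewrite ij [true == _]eq_sym eqb_id.
have neq : (i, j) != (a, b).
  by apply/eqP => -[ei ej]; move: uij; rewrite ei ej ltnNge (ltnW uab).
(* A moved pair keeps its values, and it could be $(a,b)$ only if $i=b$ and $j=a$, against $i<j$.
   For an unmoved pair, $i=a$ or $j=b$ and the other index lies strictly between; since $u(a)<u(b)$,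
   exchanging these two values leaves an inversion. *)
case: ifP => h /=; rewrite !pcompE ?tpermK ?uij ?h ?neq ?andbT /=.
  by apply/eqP => -[] /(canRL (tpermK _ _)) ei /(canRL (tpermK _ _)) ej;
    move: ij; rewrite ei ej tpermL tpermR ltnNge (ltnW ab).
move: ij h uij neq.
case: (tpermP a b i) => [-> | -> | /eqP ia /eqP ib];
  case: (tpermP a b j) => [-> | -> | /eqP ja /eqP jb]; rewrite ?eqxx //=; lia.
Qed.

Lemma card_swap_pair u a b : #|swap_pair a b @: inversions u| = #|inversions u|.
Proof. by rewrite card_imset //; apply: can_inj (swap_pairK a b). Qed.

Lemma mem_inversions_tperm u a b : a < b -> u a < u b ->
  (a, b) \in inversions (u \oS tperm a b).
Proof. by move=> ab uab; rewrite inE /= !pcompE tpermL tpermR ab. Qed.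

Lemma card_inversions_tperm u a b : a < b -> u a < u b ->
  #|inversions u| < #|inversions (u \oS tperm a b)|.
Proof.
move=> ab uab; rewrite (cardsD1 (a, b) (inversions (u \oS _))) (mem_inversions_tperm ab uab).
by rewrite ltnS -(card_swap_pair u a b) subset_leq_card // swap_pair_inversions.
Qed.

(** Exchanging neighbours reverses the order of no pair $i<j$ but $(a,b)$, so [swap_pair] is now
    onto the remaining inversions. *)
Lemma card_inversions_adjacent u a b : b = a.+1 :> nat -> u a < u b ->
  #|inversions (u \oS tperm a b)| = #|inversions u|.+1.
Proof.
move=> eb uab; have ab : a < b by rewrite eb.
rewrite (cardsD1 (a, b) (inversions (u \oS _))) (mem_inversions_tperm ab uab) add1n.
congr _.+1; rewrite -(card_swap_pair u a b); congr #|pred_of_set _|.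
apply/eqP; rewrite eqEsubset swap_pair_inversions // andbT.
apply/subsetP => -[i j]; rewrite !inE !pcompE /= => /and3P[neq ij uij].
apply/imsetP; exists (swap_pair a b (i, j)); rewrite ?swap_pairK //.
have h : tperm a b i < tperm a b j.
  move: neq ij.
  case: (tpermP a b i) => [-> | -> | /eqP ia /eqP ib];
  case: (tpermP a b j) => [-> | -> | /eqP ja /eqP jb]; rewrite ?eqxx //=;
    try move: ia ib; try move: ja jb; rewrite -?val_eqE /= ?eqxx ?xpair_eqE -?val_eqE /= => *; lia.
by rewrite inE /swap_pair /= h ij /= h.
Qed.

End Inversions.

Section CoxeterLength.
Variable n : nat.
Implicit Types (u w : 'S_n) (a b : 'I_n).

Lemma increasing_block w (lo hi : nat) :
    (forall a b, b = a.+1 :> nat -> lo <= a -> b < hi -> w a < w b) ->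
  forall a b, lo <= a -> a < b -> b < hi -> w a < w b.
Proof.
move=> step a b loa; have [d] := ubnP b; elim: d b => // d IHd b.
rewrite ltnS => bd ab bhi; have b1 : b.-1 < n by apply: leq_ltn_trans (leq_pred b) _.
have eb : b = (Ordinal b1).+1 :> nat by rewrite /= prednK //; lia.
have w1 : w (Ordinal b1) < w b by apply: step => //=; lia.
have [/val_inj -> //|neq] := eqVneq (a : nat) (Ordinal b1).
by apply: ltn_trans w1; apply: IHd => //=; move: neq => /=; lia.
Qed.

(** An increasing self-map satisfies $a\le w(a)$; the same bound for $w^{-1}$ gives equality. *)
Lemma increasing_perm1 w : (forall a b, a < b -> w a < w b) -> w = 1%g.
Proof.
move=> inc.
have ge_id u : (forall a b, a < b -> u a < u b) -> forall a, a <= u a.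
  move=> incu a; have [d] := ubnP a; elim: d a => // d IHd a; rewrite ltnS => ad.
  have [->//|a0] := posnP a.
  have a1 : a.-1 < n by apply: leq_ltn_trans (leq_pred a) _.
  have lta : Ordinal a1 < a by rewrite /=; lia.
  by have := IHd (Ordinal a1) ltac:(lia); have := incu _ _ lta; rewrite /=; lia.
have incV a b : a < b -> (w^-1)%g a < (w^-1)%g b.
  rewrite !ltnNge; apply: contra; rewrite leq_eqVlt => /orP[/eqP/val_inj/perm_inj -> //|].
  by move=> /inc; rewrite !permKV => /ltnW.
apply/permP => a; rewrite perm1; apply/val_inj/eqP; rewrite eqn_leq ge_id // andbT.
have := ge_id _ incV a; rewrite leq_eqVlt => /orP[/eqP/val_inj e|/inc].
  by rewrite {1}e permKV.
by rewrite permKV => /ltnW.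
Qed.

Lemma inversions1 : inversions (1%g : 'S_n) = set0.
Proof. by apply/setP => -[a b]; rewrite !inE /= !perm1; case: ltngtP. Qed.

Lemma pcomps1 u : u \oS 1%g = u.
Proof. by apply/permP => i; rewrite pcompE perm1. Qed.

Lemma pcomp_tpermK u a b : (u \oS tperm a b) \oS tperm a b = u.
Proof. by apply/permP => i; rewrite !pcompE tpermK. Qed.

Lemma card_inversions_descent u a b : a < b -> u b < u a ->
  #|inversions (u \oS tperm a b)| < #|inversions u|.
Proof.
move=> ab uba; rewrite -{2}(pcomp_tpermK u a b).
by apply: card_inversions_tperm; rewrite // !pcompE tpermL tpermR.
Qed.

Lemma card_inversions_simple_le u (i : 'I_n.-1) :
  #|inversions (u \oS simple i)| <= #|inversions u|.+1.
Proof.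
rewrite /simple; set a := widen_ord _ _; set b := Ordinal _.
have [uab|uba|/val_inj/perm_inj/(congr1 val)/=] := ltngtP (u a) (u b); last by lia.
  by rewrite (@card_inversions_adjacent _ u a b).
by apply/ltnW/leqW/card_inversions_descent.
Qed.

Lemma exists_descent u : u != 1%g -> exists i : 'I_n.-1,
  u (Ordinal (ord_next_proof i)) < u (widen_ord (leq_pred n) i).
Proof.
have [|/forallPn[i]] := boolP [forall i : 'I_n.-1,
  u (widen_ord (leq_pred n) i) < u (Ordinal (ord_next_proof i))].
  move/forallP => asc /eqP[]; apply: increasing_perm1 => a0 b0 ab0.
  apply: (@increasing_block u 0 n) => // a b eb _ _.
  have lta : a < n.-1 by have := ltn_ord b; lia.
  have := asc (Ordinal lta).
  by congr (val (u _) < val (u _)); apply: val_inj; rewrite /= -?eb.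
rewrite -leqNgt leq_eqVlt => /orP[/eqP/val_inj/perm_inj/(congr1 val)/=|]; first lia.
by exists i.
Qed.

Lemma has_word_inversions u : has_word u #|inversions u|.
Proof.
have [d] := ubnP #|inversions u|; elim: d u => // d IHd u; rewrite ltnS => ud.
have [->|/exists_descent[i desc]] := eqVneq u 1%g.
  by rewrite inversions1 cards0; apply/existsP; exists [tuple]; rewrite big_nil.
set v := u \oS simple i.
have eu : v \oS simple i = u by apply: pcomp_tpermK.
have vasc : v (widen_ord (leq_pred n) i) < v (Ordinal (ord_next_proof i)).
  by rewrite !pcompE tpermL tpermR.
have ev : #|inversions u| = #|inversions v|.+1.
  by rewrite -{1}eu; apply: card_inversions_adjacent.
have /existsP[t /eqP et] : has_word v #|inversions v| by apply: IHd; lia.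
(* The rightmost factor of $u=vs_i$ is the first letter, because [\prod] composes in the opposite
   order. *)
rewrite ev; apply/existsP; exists [tuple of i :: t].
by rewrite big_cons -et -/(v \oS simple i) eu.
Qed.

Lemma inversions_has_word u m : has_word u m -> #|inversions u| <= m.
Proof.
case/existsP => t /eqP ->; rewrite -{2}(size_tuple t).
elim: {t}(t : seq _) => [|i s IHs]; first by rewrite big_nil inversions1 cards0.
by rewrite big_cons; apply: leq_trans (card_inversions_simple_le _ i) _.
Qed.

(** Removing descents one by one yields a word of this size, and a letter creates at most one
    inversion, so no word is shorter. All later statements about length go through this count. *)
Lemma cox_lengthE u : cox_length u = #|inversions u|.
Proof.
rewrite /cox_length; case: ex_minnP => m hm min.
by apply/eqP; rewrite eqn_leq inversions_has_word // min // has_word_inversions.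
Qed.

Lemma bruhat_step_tperm u a b : a < b -> u a < u b -> bruhat_step u (u \oS tperm a b).
Proof.
move=> ab uab; apply/existsP; exists a; apply/existsP; exists b.
by rewrite eqxx !cox_lengthE card_inversions_tperm.
Qed.

Lemma bruhat_stepP u w : bruhat_step u w ->
  exists a b, [/\ a < b, u a < u b & w = u \oS tperm a b].
Proof.
case/existsP => a /existsP[b /andP[/eqP ->]]; rewrite !cox_lengthE.
wlog ab : a b / a < b.
  move=> H; have [ab|ba|/val_inj ->] := ltngtP a b; first exact: H.
    by rewrite tpermC; apply: H.
  by rewrite tperm1 pcomps1 ltnn.
have [uab|uba|/val_inj/perm_inj eab] := ltngtP (u a) (u b); first by exists a, b.
  by move=> /ltnW; rewrite leqNgt card_inversions_descent.
by move: ab; rewrite eab ltnn.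
Qed.

End CoxeterLength.

(** * The tableau criterion for the Bruhat order *)

Section RankCriterion.
Variable n : nat.
Implicit Types (u w : 'S_n) (a b : 'I_n).

(** This is the rank of the submatrix of the permutation matrix of $w$ on rows at least $j$ and
    columns below $p$. *)
Definition rk w (p j : nat) : nat := \sum_(q < n) ((q < p) && (j <= w q)).

Lemma rk_split w p j c : j <= c ->
  rk w p j = rk w p c + \sum_(q < n) ((q < p) && (j <= w q < c)).
Proof.
by move=> jc; rewrite -big_split /=; apply: eq_bigr => q _; lia.
Qed.

Lemma rk_tperm u a b p j : a < b -> u a < u b ->
  rk (u \oS tperm a b) p j = rk u p j + ((a < p <= b) && (u a < j <= u b)).
Proof.
move=> ab uab; have ba : b != a by rewrite -val_eqE /=; lia.
rewrite /rk (bigD1 a) // (bigD1 b) //= [in RHS](bigD1 a) // [in RHS](bigD1 b) //=.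
rewrite !pcompE tpermL tpermR.
under eq_bigr => q /andP[qa qb] do rewrite pcompE tpermD 1?eq_sym //.
by lia.
Qed.

Lemma ltn_sum_pointed a (F G : 'I_n -> nat) :
  (forall q, F q + (q == a) <= G q) -> \sum_(q < n) F q < \sum_(q < n) G q.
Proof.
move=> FG; apply: (@leq_trans (\sum_(q < n) (F q + (q == a)))).
  by rewrite big_split /= [X in _ < _ + X](bigD1 a) //= eqxx addnA addn1 ltnS leq_addr.
by apply: leq_sum => q _; apply: FG.
Qed.

(** Let $a$ be the first position where $u$ and $w$ differ, and $b$ the first one after $a$ with
    $u(a)<u(b)\le w(a)$. Then $u t_{ab}$ is above $u$ and its ranks are still bounded by those of
    $w$. The induction ends because there are at most $n^2$ inversions. *)
Lemma bruhat_rk u w : (forall p j, rk u p j <= rk w p j) -> bruhat u w.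
Proof.
have [d] := ubnP (n * n - #|inversions u|); elim: d u => // d IHd u; rewrite ltnS => ud le_uw.
have [->|neq] := eqVneq u w; first exact: connect0.
have [a ne_a eq_lt] : exists2 a, u a != w a & forall q : 'I_n, q < a -> u q = w q.
  have [a0 ne0] : exists a, u a != w a.
    apply/existsP; apply: contraNT neq => /existsPn H.
    by apply/eqP/permP => a; apply/eqP; rewrite -[_ == _]negbK.
  have [a ne_a min] := @arg_minnP _ a0 (fun a => u a != w a) (fun a => a : nat) ne0.
  by exists a => // q qa; apply: contraTeq qa => /min; rewrite -leqNgt.
(* Otherwise the rank of $u$ at $(a+1,u(a))$ would exceed that of $w$. *)
have lt_a : u a < w a.
  rewrite ltn_neqAle ne_a leqNgt; apply/negP => wu.
  have := le_uw a.+1 (u a); rewrite leqNgt => /negP; apply.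
  apply: (@ltn_sum_pointed a) => q; rewrite -val_eqE /=.
  have [/val_inj ->|qa] := eqVneq (q : nat) a; first by lia.
  by rewrite addn0; have [/eq_lt -> //|aq] := ltnP q a; lia.
(* The position [c] shows that the minimum defining [b] is taken over a nonempty set. *)
have [c uc] : exists c, u c = w a by exists ((u^-1)%g (w a)); rewrite permKV.
have ac : a < c.
  rewrite ltnNge leq_eqVlt; apply/negP => /orP[/eqP/val_inj e|ca].
    by move: ne_a; rewrite -uc e eqxx.
  have /perm_inj eca : w c = w a by rewrite -(eq_lt _ ca).
  by move: ca; rewrite eca ltnn.
have [|b /and3P[ab uab ubw] min] :=
  @arg_minnP _ c (fun b => [&& a < b, u a < u b & u b <= w a]) (fun b => b : nat).
  by rewrite ac uc lt_a /=.
apply: connect_trans (connect1 (bruhat_step_tperm ab uab)) _.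
apply: IHd => [|p j].
  have lt_inv := card_inversions_tperm ab uab.
  have le_inv : #|inversions (u \oS tperm a b)| <= n * n.
    by apply: leq_trans (max_card _) _; rewrite card_prod !card_ord.
  exact: leq_trans (ltn_sub2l (leq_trans lt_inv le_inv) lt_inv) ud.
rewrite rk_tperm //; have [/andP[/andP[ap pb] /andP[uaj jub]]|_] := boolP (_ && _); last by rewrite addn0.
(* Values above $w(a)$ are covered by the hypothesis. For values from $j$ to $w(a)$, the minimality
   of [b] leaves $u$ only positions before $a$, where it agrees with $w$, whereas $w$ also has the
   position $a$. *)
have jw : j <= (w a).+1 by lia.
rewrite (rk_split u p jw) (rk_split w p jw) addn1 -addnS leq_add //.
apply: (@ltn_sum_pointed a) => q; rewrite -val_eqE /=.
have [/val_inj ->|qa /=] := eqVneq (q : nat) a; first lia.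
have [/eq_lt -> //|aq] := ltnP q a; first by rewrite addn0.
have [qp /=|//] := ltnP q p.
have : ~~ [&& a < q, u a < u q & u q <= w a].
  by apply/negP => /min; lia.
by lia.
Qed.

End RankCriterion.

(** * Greedy matching of two families of arcs *)

Section ArcMatching.
Implicit Types (R S : seq (nat * nat)) (x y : nat * nat).

(** An arc is encoded as the pair (source, target). *)
Definition arc_rank R (i j : nat) : nat := count (fun x => (x.1 < i) && (j <= x.2)) R.
Definition arcs_above R (j : nat) : nat := count (fun x => j <= x.2) R.
Definition arcs_before R (i : nat) : nat := count (fun x => x.1 < i) R.

Lemma arc_rank_le_above R i j : arc_rank R i j <= arcs_above R j.
Proof. by apply: sub_count => x /andP[]. Qed.

Lemma arc_rank_all R i j : all (fun x => x.1 < i) R -> arc_rank R i j = arcs_above R j.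
Proof. by move=> /allP lt; apply: eq_in_count => x /lt ->. Qed.

(** A bound $i$ beyond every source turns [arc_rank] into [arcs_above]. *)
Lemma arcs_above_le R S : (forall i j, arc_rank S i j <= arc_rank R i j) ->
  forall j, arcs_above S j <= arcs_above R j.
Proof.
move=> domS j; pose N := (\max_(y <- S ++ R) y.1).+1.
have ltN T : {subset T <= S ++ R} -> all (fun y => y.1 < N) T.
  by move=> sub; apply/allP => y /sub yS; rewrite ltnS (leq_bigmax_seq (F := fst)).
rewrite -(@arc_rank_all S N); last by apply: ltN => y yS; rewrite mem_cat yS.
rewrite -(@arc_rank_all R N) //; apply: ltN => y yR.
by rewrite mem_cat yR orbT.
Qed.

(** The arc $y$ is found from the largest threshold $j\le$ [x.2] at which both families have equally
    many targets $\ge j$: it is an arc of $S$ with target $\ge j$ that does not start before $x$. *)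
Lemma arc_matching_last R S x :
    size S = (size R).+1 ->
    all (fun y => y.1 < x.1) R ->
    (forall i j, arc_rank S i j <= arc_rank (rcons R x) i j) ->
  exists2 y, y \in S & x.1 <= y.1 /\
    forall i j, arc_rank (rem y S) i j <= arc_rank R i j.
Proof.
move=> szS ltR domS.
have above := arcs_above_le domS.
have aboveE j : j <= x.2 -> arcs_above (rcons R x) j = (arcs_above R j).+1.
  by rewrite /arcs_above -cats1 count_cat /= => ->; rewrite addn0 addn1.
pose P j := (j <= x.2) && (arcs_above S j == arcs_above (rcons R x) j).
(* The threshold 0 qualifies, since both lists have the same size. *)
have exP : exists j, P j.
  exists 0; rewrite /P /= /arcs_above !(@eq_count _ (fun x => 0 <= x.2) predT) //.
  by rewrite !count_predT szS size_rcons.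
have [|j /andP[jx /eqP tight] maxj] := ex_maxnP exP (m := x.2); first by move=> j /andP[].
(* Otherwise every arc of $S$ with target $\ge j$ would start before [x.1], while $x$ itself does
   not, and the rank of $S$ at ([x.1], $j$) would be too large. *)
have /hasP[y yS /andP[xy jy]] : has (fun y => (x.1 <= y.1) && (j <= y.2)) S.
  apply: contraTT (domS x.1 j) => /hasPn H; rewrite -ltnNge.
  have -> : arc_rank S x.1 j = arcs_above S j.
    apply: eq_in_count => y yS; have := H y yS; rewrite negb_and -ltnNge.
    by case: (j <= y.2); rewrite ?andbF // andbT orbF => ->.
  rewrite tight aboveE // -(arc_rank_all _ ltR) ltnS.
  by rewrite /arc_rank -cats1 count_cat /= ltnn !addn0.
exists y => //; split=> // i j'.
have := domS i j'; rewrite /arc_rank -cats1 count_cat /= addn0 -!/(arc_rank _ _ _).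
have permS : perm_eq S (y :: rem y S) by apply: perm_to_rem.
have rankS : arc_rank S i j' = ((y.1 < i) && (j' <= y.2)) + arc_rank (rem y S) i j'.
  by rewrite /arc_rank (seq.permP permS).
(* The delicate case is when $x$ is counted and $y$ is not. All of $R$ then starts before $i$. If
   the target counts at $j'$ differ, the slack makes up for the loss of $x$; if they agree,
   maximality gives $j'\le j$, so $y$ is at least among the targets counted. *)
have [/andP[xi jx']|_] := boolP (_ && (j' <= x.2)); last by lia.
have rankR : arc_rank R i j' = arcs_above R j'.
  by apply: arc_rank_all; apply: sub_all ltR => z /ltn_trans; apply.
have := above j'; rewrite aboveE // rankS rankR.
have [_|ny] := boolP (_ && (j' <= y.2)); first by lia.
rewrite leq_eqVlt => /orP[/eqP tight'|]; last first.
  by have := arc_rank_le_above (rem y S) i j'; rewrite {2}/arcs_above (seq.permP permS) /= -/(arcs_above _ _); lia.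
have jj : j' <= j by apply: maxj; rewrite /P jx' aboveE // tight' eqxx.
move: tight'; rewrite /arcs_above (seq.permP permS) /= -!/(arcs_above _ _) (leq_trans jj jy).
by have := arc_rank_le_above (rem y S) i j'; lia.
Qed.

(* The arcs of S are listed from the last one: the y produced above is to be
   placed opposite the arc of R with the largest source. *)
Lemma arc_matching R S :
    pairwise (fun x y => x.1 < y.1) R ->
    size S = size R ->
    (forall i j, arc_rank S i j <= arc_rank R i j) ->
  exists2 T, perm_eq T S &
    (forall m j, arcs_above (take m T) j <= arcs_above (take m R) j) /\
    (forall m i, arcs_before (drop m T) i <= arcs_before (drop m R) i).
Proof.
elim/last_ind: R S => [|R x IHR] S; first by case: S => // _ _ _; exists [::].
rewrite pairwise_rcons => /andP[ltR incR]; rewrite size_rcons => szS domS.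
have [y yS [xy domR]] := arc_matching_last szS ltR domS.
have permS : perm_eq S (y :: rem y S) by apply: perm_to_rem.
have szR : size (rem y S) = size R by rewrite size_rem // szS.
have [T permT [above before]] := IHR _ incR szR domR.
have szT : size T = size R by rewrite (perm_size permT).
have permTS : perm_eq (rcons T y) S.
  by rewrite perm_rcons perm_sym (perm_trans permS) // perm_cons perm_sym.
exists (rcons T y) => //; split=> m j.
  have [mR|Rm] := leqP m (size R).
    by rewrite -!cats1 !takel_cat ?szT // above.
  rewrite !take_oversize ?size_rcons ?szT //.
  by have := arcs_above_le domS j; rewrite /arcs_above (seq.permP permTS).
have [mR|Rm] := leqP m (size R); last by rewrite drop_oversize // size_rcons szT.
rewrite !drop_rcons ?szT // /arcs_before -!cats1 !count_cat /= !addn0 leq_add ?before //.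
by case: ltnP => // yi; rewrite (leq_ltn_trans xy yi).
Qed.

End ArcMatching.

(** * The groups W_k and W(C_k), and the set Z_k *)

Section ParabolicSubgroups.
Variables n k : nat.
Implicit Types (u w s v : 'S_n) (a b : 'I_n).

Lemma gen_preserves (A : {set 'S_n}) (P : pred 'I_n) :
    (forall s, s \in A -> forall a, P (s a) = P a) ->
  forall w, w \in <<A>>%g -> forall a, P (w a) = P a.
Proof.
move=> PA w /gen_prodgP[m [c Ac ->]]; elim/big_ind: _ => [a|u v Pu Pv a|i _ a].
- by rewrite perm1.
- by rewrite permM Pv.
- exact: PA.
Qed.

Lemma simple_lt (i : 'I_n.-1) m : i.+1 != m -> forall a, (simple i a < m) = (a < m).
Proof.
move=> im a; rewrite /simple; case: tpermP => [->|->|//] /=.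
all: by move: im; lia.
Qed.

Lemma Wk_fix s a : s \in Wk n k -> k <= a -> s a = a.
Proof.
move=> sW ka.
(* The fixed point is read off from the invariance of [pred1 a] under the generators. *)
suff gen t : t \in [set simple i | i : 'I_n.-1 & i.+1 < k] ->
    forall b, pred1 a (t b) = pred1 a b.
  by have /= := gen_preserves gen sW a; rewrite eqxx => /eqP.
case/imsetP => i; rewrite inE => ik -> b /=; rewrite -[a in LHS](_ : simple i a = a).
  by rewrite (inj_eq perm_inj).
by apply: tpermD; rewrite -val_eqE /=; lia.
Qed.

Lemma WL_blocks v a : v \in WL n k ->
  ((v a < k) = (a < k)) * ((v a < n - k) = (a < n - k)).
Proof.
move=> vW; split; apply: (@gen_preserves _ (fun a => a < _) _ v vW) => _ /imsetP[i + ->] b;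
  by rewrite inE => /andP[i1 i2]; rewrite simple_lt.
Qed.

(** A descent cannot straddle $k$ or $n-k$, because the blocks are stable. The simple reflections
    split off in lowering the number of inversions therefore all lie in $W(L)$. *)
Lemma mem_WL v : (forall a, (v a < k) = (a < k)) ->
  (forall a, (v a < n - k) = (a < n - k)) -> v \in WL n k.
Proof.
have [d] := ubnP #|inversions v|; elim: d v => // d IHd v; rewrite ltnS => vd v1 v2.
have [->|/exists_descent[i desc]] := eqVneq v 1%g; first exact: group1.
set a := widen_ord _ _ in desc; set b := Ordinal _ in desc.
have ab : a < b by [].
have i1 : i.+1 != k.
  by apply/eqP => ik; have := v1 a; have := v1 b; move: desc => /=; lia.
have i2 : i.+1 != n - k.
  by apply/eqP => ik; have := v2 a; have := v2 b; move: desc => /=; lia.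
have si : simple i \in WL n k.
  by apply/mem_gen/imset_f; rewrite inE i1.
rewrite -(pcomp_tpermK v a b) groupM //; apply: IHd => [|c|c].
- exact: leq_trans (card_inversions_descent ab desc) vd.
- by rewrite pcompE v1 simple_lt.
- by rewrite pcompE v2 simple_lt.
Qed.

(** If $s$ decreased between neighbours $j-1$ and $j$, their exchange would lower the length.
    Between positions [lo] and [hi - 1] only the boundaries $j$ with [lo < j < hi] are crossed. *)
Lemma Zk_increasing s lo hi : s \in Zk n k ->
    (forall j, lo < j < hi -> (j != k) && (j != n - k)) ->
  forall a b, lo <= a -> a < b -> b < hi -> s a < s b.
Proof.
rewrite inE => /forallP Zs nb; apply: increasing_block => a b eb loa bhi.
have ltan : a < n.-1 by have := ltn_ord b; lia.
have := Zs (Ordinal ltan); rewrite nb /=; last by lia.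
rewrite /simple !cox_lengthE /=.
have -> : widen_ord (leq_pred n) (Ordinal ltan) = a by apply: val_inj.
have -> : Ordinal (ord_next_proof (Ordinal ltan)) = b by apply: val_inj; rewrite /= eb.
have ab : a < b by rewrite eb.
move=> /eqP len; have [//|ba|/val_inj/perm_inj eab] := ltngtP (s a) (s b).
  by have := card_inversions_descent ab ba; rewrite len ltnNge leqnSn.
by move: ab; rewrite eab ltnn.
Qed.

Lemma mem_WC v : (v \in WC n k) <-> v \in WL n k /\
  forall a b, a < k -> b = n - k + a :> nat -> v b = n - k + v a :> nat.
Proof.
rewrite !inE; split=> [/andP[-> /forallP H]|[-> H]]; last first.
  by apply/forallP => a; apply/forallP => b; apply/implyP => /andP[ak /eqP eb]; apply/eqP/H.
split=> // a b ak /eqP eb; have /forallP/(_ b)/implyP := H a.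
by rewrite ak eb => /(_ isT)/eqP.
Qed.

Lemma group_set_WC : group_set (WC n k).
Proof.
apply/group_setP; split=> [|u v /mem_WC[uL u2] /mem_WC[vL v2]]; apply/mem_WC.
  by split=> [|a b _ eb]; rewrite ?group1 // !perm1.
split=> [|a b ak eb]; first exact: groupM.
by rewrite !permM; apply: v2; [rewrite (WL_blocks _ uL)|apply: u2].
Qed.

(** Since the library product is reversed, the left coset $uW(C_k)$ is a right coset there. *)
Lemma pcoset_eqP u w : (pcoset u (WC n k) = pcoset w (WC n k)) <->
  exists2 v, v \in WC n k & w = u \oS v.
Proof.
pose G := Group group_set_WC.
have E x : pcoset x (WC n k) = (G :* x)%g.
  by rewrite /pcoset /pcomp -rcosetE /rcoset.
rewrite !E; split=> [eq_uw|[v vG ->]].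
  have /rcosetP[v vG ->] : w \in (G :* u)%g by rewrite eq_uw rcoset_refl.
  by exists v.
by apply/esym/rcoset_eqP/rcosetP; exists v.
Qed.

End ParabolicSubgroups.

(** * From arcs to the Bruhat order *)

Section ArcsOfPermutations.
Variables n k : nat.
Implicit Types (u w s v : 'S_n) (a b : 'I_n).

(* Extension by the identity, so that arcs can be indexed by plain numbers. *)
Definition permn w (i : nat) : nat := if insub i is Some a then w a else i.

Lemma permnE w a : permn w a = w a.
Proof. by rewrite /permn valK. Qed.

Lemma perm_of_nat (f : nat -> nat) :
    (forall i, i < n -> f i < n) -> {in gtn n &, injective f} ->
  exists v, forall a, v a = f a :> nat.
Proof.
move=> ltf injf; pose g (a : 'I_n) := Ordinal (ltf a (ltn_ord a)).
have injg : injective g.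
  move=> a b /(congr1 val) /= e; apply/val_inj/injf => //; exact: ltn_ord.
by exists (perm injg) => a; rewrite permE.
Qed.

(** The order of the list matters: a prefix records $w$ at the start of the first block, a suffix at
    the end of the last block. *)
Definition arcs w : seq (nat * nat) :=
  [seq (permn w (n - k + m), permn w m) | m <- iota 0 k].

Lemma size_arcs w : size (arcs w) = k.
Proof. by rewrite size_map size_iota. Qed.

Lemma rk_count w p j : p <= n -> rk w p j = count (fun q => j <= permn w q) (iota 0 p).
Proof.
move=> pn; rewrite /rk.
under eq_bigr => q _ do rewrite -permnE.
rewrite -(big_mkord xpredT (fun q => nat_of_bool ((q < p) && (j <= permn w q)))).
rewrite (@big_cat_nat _ _ _ p) //= [X in _ + X]big_nat_cond [X in _ + X]big1 ?addn0; last first.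
  by move=> q /andP[/andP[pq _] _]; rewrite ltnNge pq.
rewrite -sum1_count [RHS]big_mkcond /index_iota subn0 big_seq [RHS]big_seq.
by apply: eq_bigr => q; rewrite mem_iota => /andP[_ ->]; case: (j <= _).
Qed.

Lemma rk_above w p j : p <= k -> k <= n -> rk w p j = arcs_above (take p (arcs w)) j.
Proof.
move=> pk kn; rewrite rk_count ?(leq_trans pk) // /arcs_above /arcs -map_take take_iota.
by rewrite (minn_idPl pk) count_map.
Qed.

Lemma rk_full w j p : n <= p -> rk w p j = \sum_(q < n) (j <= q).
Proof.
move=> np; rewrite [RHS](reindex_inj (@perm_inj _ w)) /=.
by apply: eq_bigr => q _; rewrite (leq_trans (ltn_ord q) np).
Qed.

(** Each of the $n-p$ positions from $p$ on either has a value $\ge j$, which completes the rank to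
    that at $n$, or is a source below $j$ in the suffix. *)
Lemma rk_before w p j : k <= n -> n - k <= p <= n ->
  rk w p j + (n - p) = rk w n j + arcs_before (drop (p - (n - k)) (arcs w)) j.
Proof.
move=> kn /andP[kp pn]; rewrite !rk_count // -{2}(subnKC pn) iotaD count_cat -addnA.
congr (_ + _); rewrite /arcs_before -map_drop drop_iota count_map add0n.
rewrite -[n - p in LHS](size_iota (0 + p)) -(count_predC (fun q => j <= permn w q)).
congr (_ + _); rewrite (_ : iota (0 + p) _ = map (addn (n - k)) (iota (p - (n - k)) (k - (p - (n - k))))).
  by rewrite count_map; apply: eq_count => q /=; rewrite -ltnNge.
by rewrite -iotaDl; congr iota; lia.
Qed.

Lemma rk_leq w p p' j : p <= p' -> rk w p j <= rk w p' j.
Proof. by move=> pp; apply: leq_sum => q _; lia. Qed.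

(** Prefixes control the ranks with $p\le k$, suffixes those with $p\ge n-k$. For $p$ in between,
    monotonicity of $u$ leaves two cases. If $u(p-1)<j$, no middle position below $p$ counts for
    $u$, and $p$ can be lowered to $k$. Otherwise all middle positions from $p$ on count for $u$,
    and $p$ can be raised to $n-k$. *)
Lemma bruhat_arcs u w : 2 * k <= n ->
    (forall a b, k <= a -> a < b -> b < n - k -> u a < u b) ->
    (forall m j, arcs_above (take m (arcs u)) j <= arcs_above (take m (arcs w)) j) ->
    (forall m i, arcs_before (drop m (arcs u)) i <= arcs_before (drop m (arcs w)) i) ->
  bruhat u w.
Proof.
move=> kn incu above before; apply: bruhat_rk => p j.
have [np|pn] := leqP n p; first by rewrite !rk_full.
have first p' : p' <= k -> rk u p' j <= rk w p' j.
  by move=> pk; rewrite !rk_above //; lia.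
have third p' : n - k <= p' <= n -> rk u p' j <= rk w p' j.
  move=> kp; have := before (p' - (n - k)) j.
  have := rk_before u j _ kp; have := rk_before w j _ kp; rewrite !(@rk_full _ _ n) //.
  by move=> /(_ ltac:(lia)) ew /(_ ltac:(lia)) eu; lia.
have [pk|kp] := leqP p k; first exact: first.
have [kp'|pk] := leqP (n - k) p; first by apply: third; lia.
have p1 : p.-1 < n by lia.
have [lt_j|ge_j] := ltnP (u (Ordinal p1)) j.
  apply: leq_trans (rk_leq w j (ltnW kp)); apply: leq_trans (first k (leqnn k)).
  apply: leq_sum => q _; have [kq|] := leqP k q; last by lia.
  have [qp /=|//] := ltnP q p.
  have [eq|neq] := eqVneq (q : nat) p.-1.
    have -> : q = Ordinal p1 by apply: val_inj.
    by rewrite [j <= _]leqNgt lt_j.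
  have lt_up : u q < u (Ordinal p1) by apply: incu => //=; lia.
  by rewrite [j <= _]leqNgt (ltn_trans lt_up lt_j).
pose D := \sum_(q < n) (p <= q < n - k).
have le_u : rk u p j + D <= rk u (n - k) j.
  rewrite -big_split /=; apply: leq_sum => q _.
  have [qp|pq /=] := ltnP q p; first by rewrite /= addn0; lia.
  have [qk /=|//] := ltnP q (n - k).
  have lt_up : u (Ordinal p1) < u q by apply: incu => //=; lia.
  by rewrite (leq_trans ge_j (ltnW lt_up)).
have le_w : rk w (n - k) j <= rk w p j + D.
  by rewrite -big_split /=; apply: leq_sum => q _; lia.
by have := third (n - k) ltac:(lia); lia.
Qed.

(** Monotonicity of $w$ on the last block sorts its arcs by source, as the greedy matching requires.
    The resulting reordering of the arcs of $u$ is realized by an element of $W(C_k)$. *)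
Lemma exists_WC_bruhat u w : 2 * k <= n ->
    (forall a b, k <= a -> a < b -> b < n - k -> u a < u b) ->
    (forall a b, n - k <= a -> a < b -> w a < w b) ->
    (forall i j, arc_rank (arcs u) i j <= arc_rank (arcs w) i j) ->
  exists2 v, v \in WC n k & bruhat (u \oS v) w.
Proof.
move=> kn incu incw dom.
have incR : pairwise (fun x y => x.1 < y.1) (arcs w).
  rewrite pairwise_map; apply: (@sub_in_pairwise _ (gtn k) ltn).
  - move=> x y; rewrite !inE => xk yk xy /=.
    have ltx : n - k + x < n by lia.
    have lty : n - k + y < n by lia.
    rewrite -[n - k + x]/(val (Ordinal ltx)) -[n - k + y]/(val (Ordinal lty)) !permnE.
    by apply: incw => /=; lia.
  - by apply/allP => x; rewrite mem_iota.
  - by rewrite -sorted_pairwise ?iota_ltn_sorted //; apply: ltn_trans.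
have [|T /(perm_iotaP (0, 0))[I permI eT] [above before]] := arc_matching incR _ dom.
  by rewrite !size_arcs.
rewrite size_arcs in permI.
have szI : size I = k by rewrite (perm_size permI) size_iota.
have uniqI : uniq I by rewrite (perm_uniq permI) iota_uniq.
have ltI i : i < k -> nth 0 I i < k.
  by move=> ik; have := mem_nth 0 (_ : i < size I); rewrite szI (perm_mem permI) mem_iota => /(_ ik).
(* The same reordering [I] acts on the first and on the last $k$ positions, with the identity in
   between; this is the shape of an element of $W(C_k)$. *)
pose f i := if i < k then nth 0 I i else if n - k <= i then n - k + nth 0 I (i - (n - k)) else i.
have fP i : [\/ i < k /\ f i = nth 0 I i,
    k <= i < n - k /\ f i = i |
    n - k <= i /\ f i = n - k + nth 0 I (i - (n - k))].
  rewrite /f; have [ik|ki] := ltnP i k; first by constructor 1.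
  have [nki|ink] := leqP (n - k) i; first by constructor 3.
  by constructor 2.
have ltf i : i < n -> f i < n.
  move=> lti; have := ltI i; have := ltI (i - (n - k)).
  by case: (fP i) => -[ci ->]; lia.
have injf : {in gtn n &, injective f}.
  move=> x y; rewrite !inE => xn yn.
  have nthI i j : i < k -> j < k -> nth 0 I i = nth 0 I j -> i = j.
    by move=> ik jk /eqP; rewrite nth_uniq ?szI // => /eqP.
  have := ltI x; have := ltI y; have := ltI (x - (n - k)); have := ltI (y - (n - k)).
  have := nthI x y; have := nthI (x - (n - k)) (y - (n - k)).
  by case: (fP x) => -[cx ->]; case: (fP y) => -[cy ->]; lia.
have [v vf] := perm_of_nat ltf injf.
exists v.
  apply/mem_WC; split=> [|a b ak eb].
    apply: mem_WL => a; rewrite vf; have := ltI a; have := ltI (a - (n - k));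
      have := ltn_ord a; by case: (fP a) => -[ca ->]; lia.
  by rewrite !vf eb; case: (fP a) => -[ca ->]; case: (fP (n - k + a)) => -[cb ->];
    rewrite ?addKn //; lia.
have arcsE : arcs (u \oS v) = T.
  have permn_v i : i < n -> permn (u \oS v) i = permn u (f i).
    by move=> lti; rewrite -[i]/(val (Ordinal lti)) permnE pcompE -vf permnE.
  rewrite eT; apply: (@eq_from_nth _ (0, 0)) => [|m].
    by rewrite size_arcs size_map szI.
  rewrite size_arcs => mk; rewrite !(nth_map 0) ?size_iota ?szI ?ltI //.
  rewrite !nth_iota ?ltI // !add0n !permn_v; try lia.
  by case: (fP m) => -[cm ->]; case: (fP (n - k + m)) => -[cm' ->];
    rewrite ?addKn //; lia.
apply: bruhat_arcs => //; rewrite ?arcsE // => a b ka ab bk.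
have := vf a; have := vf b.
by case: (fP b) => -[cb ->] eb; case: (fP a) => -[ca ->] ea; rewrite !pcompE; apply: incu; lia.
Qed.

End ArcsOfPermutations.

(** * Ranks and closures of B-orbits *)

Import GRing.Theory.

Section Matrices.
Local Open Scope ring_scope.
Variables (K : fieldType) (n : nat).
Implicit Types (w u v : 'S_n) (A b c g x y : 'M[K]_n).

Lemma conjmx_byP g x y : g \in unitmx -> g *m x = y *m g -> conjmx_by g x = y.
Proof. by move=> ug e; rewrite /conjmx_by e mulmxK. Qed.

Lemma conjmx_byE g x : g \in unitmx -> g *m x = conjmx_by g x *m g.
Proof. by move=> ug; rewrite /conjmx_by mulmxKV. Qed.

Lemma conjmx_by_mul g h x : g \in unitmx -> h \in unitmx ->
  conjmx_by (g *m h) x = conjmx_by g (conjmx_by h x).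
Proof.
move=> ug uh; apply: conjmx_byP; first by rewrite unitmx_mul ug.
by rewrite -mulmxA (conjmx_byE x uh) mulmxA (conjmx_byE _ ug) mulmxA.
Qed.

Lemma mul_wdot_l w A i j : (wdot K w *m A) (w i) j = A i j.
Proof.
rewrite mxE (bigD1 i) //= mxE eqxx mul1r big1 ?addr0 // => r ri.
by rewrite mxE (inj_eq perm_inj) eq_sym (negPf ri) mul0r.
Qed.

Lemma mul_wdot_r w A i j : (A *m wdot K w) i j = A i (w j).
Proof.
rewrite mxE (bigD1 (w j)) //= mxE eqxx mulr1 big1 ?addr0 // => r ri.
by rewrite mxE (negPf ri) mulr0.
Qed.

Lemma wdotM u w : wdot K u *m wdot K w = wdot K (u \oS w).
Proof. by apply/matrixP => i j; rewrite mul_wdot_r !mxE pcompE. Qed.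

Lemma wdot1 : wdot K (1%g : 'S_n) = 1%:M.
Proof. by apply/matrixP => i j; rewrite !mxE perm1. Qed.

Lemma wdot_unit w : wdot K w \in unitmx.
Proof.
suff /mulmx1_unit[] : wdot K w *m wdot K (w^-1)%g = 1%:M by [].
by rewrite wdotM -wdot1; congr wdot; apply/permP => i; rewrite pcompE permKV perm1.
Qed.

Lemma BorelP b : Borel b <->
  (forall i j : 'I_n, (j < i)%N -> b i j = 0) /\ (forall i, b i i != 0).
Proof.
have det_b : (forall i j : 'I_n, (j < i)%N -> b i j = 0) -> \det b = \prod_i b i i.
  move=> tr; rewrite -det_tr det_trig; first by apply: eq_bigr => i _; rewrite mxE.
  by apply/is_trig_mxP => i j ij; rewrite mxE tr.
rewrite /Borel unitmxE unitfE; split=> [[ub tr]|[tr nz]]; split=> //.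
  by move=> i; move: ub; rewrite det_b // => /prodf_neq0; apply.
by rewrite det_b //; apply/prodf_neq0.
Qed.

Lemma Borel1 : Borel (1%:M : 'M[K]_n).
Proof.
apply/BorelP; split=> [i j ij|i]; rewrite mxE ?eqxx ?oner_neq0 //.
by rewrite -val_eqE /= gtn_eqF.
Qed.

Lemma BorelM b c : Borel b -> Borel c -> Borel (b *m c).
Proof.
case=> ub tb [uc tc]; split=> [|i j ij]; first by rewrite unitmx_mul ub.
rewrite mxE big1 // => r _; have [ri|ir] := ltnP r i; first by rewrite tb ?mul0r.
by rewrite tc ?mulr0 // (leq_trans ij).
Qed.

(** If column $j$ of $b^{-1}$ had nonzero entries below the diagonal, let $i$ be the row of the
    lowest one. The entry $(i,j)$ of $bb^{-1}$ would reduce to $b_{ii}(b^{-1})_{ij}\ne 0$. *)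
Lemma BorelV b : Borel b -> Borel (invmx b).
Proof.
move=> Bb; have [ub tb] := Bb; have [_ nz] := (BorelP b).1 Bb.
split=> [|i0 j ij0]; first by rewrite unitmx_inv.
apply/eqP; apply: contraTT isT => nz0.
have [|i /andP[ij nzi] max] := @arg_maxnP _ i0
  (fun i : 'I_n => (j < i)%N && (invmx b i j != 0)) (fun i => i : nat); first by rewrite ij0.
have /matrixP/(_ i j) := mulmxV ub; rewrite [RHS]mxE -val_eqE /= (gtn_eqF ij).
rewrite mxE (bigD1 i) //= big1 => [/eqP|r ri].
  by rewrite addr0 mulf_eq0 (negPf (nz i)) (negPf nzi).
have [lt_ri|ir] := ltnP r i; first by rewrite tb ?mul0r.
have lt_ir : (i < r)%N by rewrite ltn_neqAle ir eq_sym andbT.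
have [->|nzr] := eqVneq (invmx b r j) 0; first by rewrite mulr0.
by have := max r; rewrite nzr (ltn_trans ij lt_ir) /= leqNgt lt_ir => /(_ isT).
Qed.

Lemma det_mxsub_closed m (f g : 'I_m -> 'I_n) :
  zariski_closed (fun x : 'M[K]_n => \det (mxsub f g x) = 0).
Proof.
pose P : 'M[{mpoly K[n * n]}]_m := \matrix_(i, j) 'X_(mxvec_index (f i) (g j)).
have detP x : mxeval (\det P) x = \det (mxsub f g x).
  rewrite /mxeval -det_map_mx; congr (\det _); apply/matrixP => i j.
  by rewrite !mxE /= mevalXU mxvecE.
exists (eq (\det P)) => x; rewrite -detP; split=> [e _ <- //|]; exact.
Qed.

Lemma rank_sum_le (I : Type) (r : seq I) (P : pred I) m p (F : I -> 'M[K]_(m, p)) :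
  (forall i, (\rank (F i) <= P i)%N) -> (\rank (\sum_(i <- r) F i)%R <= count P r)%N.
Proof.
move=> rF; elim: r => [|i r IHr]; first by rewrite big_nil mxrank0.
by rewrite big_cons (leq_trans (mxrank_add _ _)) // leq_add.
Qed.

Lemma det0_rank m (A : 'M[K]_m) : (\rank A < m)%N -> \det A = 0.
Proof.
move=> rA; apply/eqP; apply: contraTT rA => nz.
by rewrite mxrank_unit ?ltnn // unitmxE unitfE.
Qed.

Lemma rank_mxsub m p (f : 'I_m -> 'I_n) (g : 'I_p -> 'I_n) A :
  (\rank (mxsub f g A) <= \rank A)%N.
Proof.
rewrite mxsubrc rowsubE.
by rewrite (leq_trans (mxrankM_maxr _ _)) // -[A in colsub _ A]mulmx1 -mulmx_colsub mxrankM_maxl.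
Qed.

End Matrices.

(** * The matrices $w x_k w^{-1}$ and their minors *)

Section NilpotentOrbit.
Local Open Scope ring_scope.
Variables (K : fieldType) (n k : nat) (hk : (2 * k <= n)%N).
Implicit Types (w u v : 'S_n) (b c d g x y : 'M[K]_n).

Fact target_proof (m : 'I_k) : (m < n)%N. Proof. by have := ltn_ord m; lia. Qed.
Fact source_proof (m : 'I_k) : (n - k + m < n)%N. Proof. by have := ltn_ord m; lia. Qed.
Definition target m : 'I_n := Ordinal (target_proof m).
Definition source m : 'I_n := Ordinal (source_proof m).

Definition arcmx w : 'M[K]_n := \sum_(m < k) delta_mx (w (target m)) (w (source m)).

Lemma wdot_delta w (i j : 'I_n) : wdot K w *m delta_mx i j = delta_mx (w i) (w j) *m wdot K w.
Proof.
apply/matrixP => p q; rewrite mul_wdot_r -[p](permKV w) mul_wdot_l !mxE.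
by rewrite !(inj_eq perm_inj).
Qed.

Lemma xkE : xk K n k = \sum_(m < k) delta_mx (target m) (source m).
Proof.
apply/matrixP => i j; rewrite mxE summxE.
have [/andP[kj /eqP ei]|nij] := boolP (_ && _).
  have lti : (i < k)%N by have := ltn_ord j; lia.
  rewrite (bigD1 (Ordinal lti)) //= big1 ?addr0 => [|m mi]; rewrite mxE -!val_eqE /=.
    by rewrite eqxx (_ : j == n - k + i :> nat)%N //; lia.
  by move: mi; rewrite -val_eqE /= eq_sym => /negPf ->.
rewrite big1 // => m _; rewrite mxE -!val_eqE /=.
by rewrite [_ && _](_ : _ = false) //; move: nij; lia.
Qed.

Lemma conjmx_by_wdot w : conjmx_by (wdot K w) (xk K n k) = arcmx w.
Proof.
apply: conjmx_byP; first exact: wdot_unit.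
rewrite xkE mulmx_sumr mulmx_suml; apply: eq_bigr => m _; exact: wdot_delta.
Qed.

Lemma target_source m m' : (target m == source m') = false.
Proof. by rewrite -val_eqE /=; have := ltn_ord m; lia. Qed.

(** Distinct arcs have distinct sources and distinct targets. This gives both the lower bound on the
    rank and the minors equal to 1. *)
Lemma mxsub_arcmx w (p : nat) (h : 'I_p -> 'I_k) : injective h ->
  mxsub (fun i => w (target (h i))) (fun i => w (source (h i))) (arcmx w) = 1%:M.
Proof.
move=> injh; apply/matrixP => i j; rewrite !mxE summxE.
have tgtE m : (w (target (h i)) == w (target m)) = (h i == m) by rewrite (inj_eq perm_inj).
have srcE m : (w (source (h j)) == w (source m)) = (h j == m).
  by rewrite (inj_eq perm_inj) -val_eqE /= eqn_add2l.
rewrite (bigD1 (h i)) //= big1 ?addr0 => [|m mi]; rewrite mxE tgtE srcE.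
  by rewrite eqxx /= eq_sym (inj_eq injh).
by rewrite eq_sym (negPf mi).
Qed.

(** The square vanishes because $2k\le n$ keeps sources and targets disjoint. *)
Lemma Ok_arcmx w : Ok k (arcmx w).
Proof.
split.
  rewrite /arcmx mulmx_suml big1 // => m _; rewrite mulmx_sumr big1 // => m' _.
  by rewrite mul_delta_mx_0 // (inj_eq perm_inj) eq_sym target_source.
apply/eqP; rewrite eqn_leq; apply/andP; split.
  rewrite -[X in (_ <= X)%N](size_enum_ord k) -(count_predT (enum 'I_k)) /arcmx -big_enum.
  by apply: rank_sum_le => m; rewrite mxrank_delta.
rewrite -[X in (X <= _)%N](mxrank1 K k) -(mxsub_arcmx w (@inj_id 'I_k)).
exact: rank_mxsub.
Qed.

Lemma arc_rankE w i j : arc_rank (arcs k w) i j =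
  #|[pred m : 'I_k | (w (source m) < i)%N && (j <= w (target m))%N]|.
Proof.
rewrite cardE size_filter -enumT /arc_rank /arcs count_map -val_enum_ord count_map.
apply: eq_count => m /=.
rewrite -[(n - k + m)%N]/(val (source m)) permnE.
by rewrite -[X in permn w X]/(val (target m)) permnE.
Qed.

(** The conjugate is a sum over arcs of a column of $b$ times a row of $b^{-1}$. By triangularity,
    an arc with target below $j$ vanishes on the chosen rows and one with source at least $i$ on the
    chosen columns, so fewer than $p$ terms of rank at most one remain. *)
Lemma det_mxsub_arcmx0 b w p (f g : 'I_p -> 'I_n) i j : Borel b ->
    (forall r, (j <= f r)%N) -> (forall r, (g r < i)%N) ->
    (arc_rank (arcs k w) i j < p)%N ->
  \det (mxsub f g (conjmx_by b (arcmx w))) = 0.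
Proof.
move=> Bb lef ltg lt_p; apply: det0_rank; apply: leq_ltn_trans lt_p.
have [_ tb] := Bb; have [_ tc] := BorelV Bb.
rewrite arc_rankE cardE size_filter -enumT.
have -> : mxsub f g (conjmx_by b (arcmx w)) = \sum_(m <- enum 'I_k)
    rowsub f (col (w (target m)) b) *m colsub g (row (w (source m)) (invmx b)).
  rewrite big_enum /= /conjmx_by /arcmx mulmx_sumr mulmx_suml.
  apply/matrixP => r s; rewrite !mxE summxE [RHS]summxE; apply: eq_bigr => m _.
  rewrite [RHS]mxE big_ord1 !mxE (bigD1 (w (source m))) //= big1 ?addr0.
    rewrite mxE (bigD1 (w (target m))) //= big1 ?addr0.
      by rewrite mxE !eqxx mulr1.
    by move=> t nt; rewrite mxE (negPf nt) mulr0.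
  move=> t nt; rewrite mxE big1 ?mul0r // => t' _.
  by rewrite mxE (negPf nt) andbF mulr0.
apply: rank_sum_le => m /=.
rewrite inE; have [_|] := boolP (_ && _).
  by apply: leq_trans (mxrankM_maxr _ _) (rank_leq_row _).
rewrite negb_and -leqNgt -ltnNge leqn0 mxrank_eq0 => /orP[le_i|lt_j].
  rewrite (_ : colsub g _ = 0) ?mulmx0 //; apply/matrixP => r s; rewrite !mxE.
  by apply: tc; apply: leq_trans (ltg s) le_i.
rewrite (_ : rowsub f _ = 0) ?mul0mx //; apply/matrixP => r s; rewrite !mxE.
by apply: tb; apply: leq_trans lt_j (lef r).
Qed.

(* The minor of u on the rows and columns of the arcs counted in [arc_rank]
   is a polynomial which is 1 at [arcmx u] and 0 on the orbit of [arcmx w]. *)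
Lemma arc_rank_closure u w :
    (forall F, zariski_closed F ->
      (forall b, Borel b -> F (conjmx_by b (arcmx w))) -> F (arcmx u)) ->
  forall i j, (arc_rank (arcs k u) i j <= arc_rank (arcs k w) i j)%N.
Proof.
move=> clos i j; rewrite leqNgt; apply/negP => lt_wu.
have := lt_wu; rewrite [X in (_ < X)%N]arc_rankE; set A := [pred m | _] => lt_wA.
pose h : 'I_#|A| -> 'I_k := enum_val.
have injh : injective h by apply: enum_val_inj.
have hA r : (u (source (h r)) < i)%N /\ (j <= u (target (h r)))%N.
  by have /andP := enum_valP r.
have det0 b : Borel b -> \det (mxsub (fun r => u (target (h r)))
    (fun r => u (source (h r))) (conjmx_by b (arcmx w))) = 0.
  by move=> Bb; apply: (det_mxsub_arcmx0 (i := i) (j := j)) => // r; have [] := hA r.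
have /eqP := clos _ (@det_mxsub_closed K n _ _ _) det0.
by rewrite mxsub_arcmx // det1 oner_eq0.
Qed.

End NilpotentOrbit.

(** * Elementary matrices and double cosets of the Borel subgroup *)

Section ElementaryMatrices.
Local Open Scope ring_scope.
Variables (K : fieldType) (n : nat).
Implicit Types (u w v : 'S_n) (b c d g x y : 'M[K]_n).

Definition elem (i j : 'I_n) (s : K) : 'M[K]_n := 1%:M + s *: delta_mx i j.

Lemma elem_mulN i j s : i != j -> elem i j s *m elem i j (- s) = 1%:M.
Proof.
move=> ij; rewrite /elem mulmxDl mul1mx mulmxDr mulmx1 -!scalemxAl -!scalemxAr.
by rewrite mul_delta_mx_0 1?eq_sym // !scaler0 addr0 scaleNr -addrA addNr addr0.
Qed.

Lemma elem_unit i j s : i != j -> elem i j s \in unitmx.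
Proof. by move=> ij; have [] := mulmx1_unit (elem_mulN s ij). Qed.

Lemma elem_inv i j s : i != j -> invmx (elem i j s) = elem i j (- s).
Proof.
move=> ij; rewrite -[RHS]mul1mx -(mulVmx (elem_unit s ij)) -mulmxA elem_mulN //.
by rewrite mulmx1.
Qed.

Lemma Borel_elem (i j : 'I_n) s : (i < j)%N -> Borel (elem i j s).
Proof.
move=> ij; split=> [|p q qp]; first by rewrite elem_unit // -val_eqE neq_ltn ij.
rewrite !mxE -!val_eqE /= (gtn_eqF qp) add0r.
by case: eqP => [ep|]; case: eqP => [eq|] /=; rewrite ?mulr0 //; lia.
Qed.

Lemma wdot_elem w i j s : wdot K w *m elem i j s = elem (w i) (w j) s *m wdot K w.
Proof. by rewrite mulmxDr mulmxDl mulmx1 mul1mx -scalemxAr wdot_delta scalemxAl. Qed.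

(* In rank one: (1, 0; s, 1) = (1, 1/s; 0, 1) (0, 1; 1, 0) (s, 1; 0, -1/s). *)
Lemma Borel_lower_elem (a b : 'I_n) s : (a < b)%N -> s != 0 ->
  Borel (wdot K (tperm a b) *m (elem a b (- s^-1) *m elem b a s)).
Proof.
move=> ab s0; have nab : a != b by rewrite -val_eqE neq_ltn ab.
split; first by rewrite !unitmx_mul wdot_unit !elem_unit // eq_sym.
have -> : elem a b (- s^-1) *m elem b a s =
    1%:M + s *: delta_mx b a - s^-1 *: delta_mx a b - delta_mx a a.
  rewrite {1}/elem mulmxDl mul1mx {2}/elem mulmxDr mulmx1 -!scalemxAl -!scalemxAr.
  by rewrite mul_delta_mx scalerA mulNr mulVf // scaleN1r scaleNr addrA.
move=> i j ji; rewrite -{1}[i](tpermK a b) mul_wdot_l !mxE.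
have nij : (i == j) = false by rewrite -val_eqE /= (gtn_eqF ji).
case: (tpermP a b i) => [ei|ei|/eqP ia /eqP ib].
- rewrite ei in ji; rewrite eqxx /= [b == a]eq_sym (negPf nab) /= !mulr0 !subr0.
  have [-> ->] : (b == j) = false /\ (j == a) = false.
    by rewrite -!val_eqE /=; lia.
  by rewrite !mulr0 addr0.
- rewrite ei in ji; rewrite eqxx (negPf nab) /= (_ : (j == b) = false).
    by rewrite mulr0 addr0 mulr0 subr0 eq_sym subrr.
  by rewrite -val_eqE /=; lia.
by rewrite nij (negPf ia) (negPf ib) /= !mulr0 !subr0 addr0.
Qed.

(** Borel factors are allowed on both sides because factoring the degenerating curve produces one to
    the right of $w$. *)
Definition BwB_orbit x w y : Prop :=
  exists b c, [/\ Borel b, Borel c & y = conjmx_by (b *m wdot K w *m c) x].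

End ElementaryMatrices.

(** * Degeneration along the Bruhat order *)

Section Degeneration.
Local Open Scope ring_scope.
Variables (K : closedFieldType) (n : nat).
Implicit Types (u w v : 'S_n) (b c d g x y : 'M[K]_n).

(** Every scalar is a root of $qX$, and over an algebraically closed field a nonzero polynomial has
    a non-root. *)
Lemma poly_eq0_punctured (q : {poly K}) : (forall s, s != 0 -> q.[s] = 0) -> q = 0.
Proof.
move=> q0; apply/eqP; rewrite -[_ == 0]orbF -(polyX_eq0 K) -mulf_eq0.
apply: contraT => /closed_nonrootP[s]; rewrite rootE hornerM hornerX.
by have [->|/q0 ->] := eqVneq s 0; rewrite ?mulr0 ?mul0r eqxx.
Qed.

Lemma closed_curve (F : 'M[K]_n -> Prop) (P : 'M[{poly K}]_n) : zariski_closed F ->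
    (forall s, s != 0 -> F (map_mx (horner_eval s) P)) ->
  F (map_mx (horner_eval 0) P).
Proof.
case=> I FI FP; apply/FI => p Ip.
(* This is $p$ evaluated along the curve, expanded into monomials so as to be a polynomial in the
   parameter. *)
pose q := \sum_(m <- msupp p) p@_m *: \prod_i (mxvec P ord0 i) ^+ m i.
have qE s : mxeval p (map_mx (horner_eval s) P) = q.[s].
  rewrite /mxeval mevalE /q horner_sum; apply: eq_bigr => m _.
  rewrite hornerZ horner_prod; congr (_ * _); apply: eq_bigr => i _.
  by rewrite horner_exp -map_mxvec mxE.
rewrite qE (_ : q = 0) ?horner0 //; apply: poly_eq0_punctured => s s0.
by rewrite -qE; apply: (FI _).1 (FP s s0) _ Ip.
Qed.

Lemma BwB_orbit_step (F : 'M[K]_n -> Prop) x u w : zariski_closed F ->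
    (forall y, BwB_orbit x w y -> F y) -> bruhat_step u w ->
  forall y, BwB_orbit x u y -> F y.
Proof.
move=> clF Fw /bruhat_stepP[i [j [ij uij ew]]] _ [b [c [Bb Bc ->]]]; rewrite {}ew in Fw.
have nij : j != i by rewrite -val_eqE neq_ltn ij orbT.
have [[ub _] [uc _]] := (Bb, Bc); have uu := wdot_unit K u.
pose L s := b *m wdot K u *m elem j i s *m c.
have FL s : s != 0 -> F (conjmx_by (L s) x).
  move=> s0; apply: Fw.
  (* The lower factor $1+sE_{ji}$ equals $1+s^{-1}E_{ij}$ times an element of $t_{ij}B$. The first
     factor passes to the left of $u$, where it stays upper triangular since $u(i)<u(j)$. *)
  exists (b *m elem (u i) (u j) s^-1),
    (wdot K (tperm i j) *m (elem i j (- s^-1) *m elem j i s) *m c).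
  split; [exact: BorelM (Borel_elem _ _) | exact: BorelM (Borel_lower_elem _ _) _ |].
  have tt : wdot K (tperm i j) *m wdot K (tperm i j) = 1%:M.
    by rewrite wdotM -wdot1; congr wdot; apply/permP => p; rewrite pcompE tpermK perm1.
  congr conjmx_by; rewrite -wdotM /L !mulmxA -(mulmxA _ _ (wdot K _)) tt mulmx1.
  by rewrite -(mulmxA b (elem _ _ _)) -wdot_elem mulmxA -(mulmxA _ (elem i j s^-1)) elem_mulN // 1?eq_sym ?mulmx1.
pose lift (A : 'M[K]_n) := map_mx polyC A.
pose D : 'M[{poly K}]_n := 'X *: delta_mx j i.
(* Since $i\ne j$, the inverse of $1+D$ is $1-D$, so the conjugate is polynomial in the
   parameter. *)
pose P := lift b *m lift (wdot K u) *m (1%:M + D) *m lift (conjmx_by c x) *m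
  (1%:M - D) *m lift (invmx (b *m wdot K u)).
have PE s : map_mx (horner_eval s) P = conjmx_by (L s) x.
  have liftE A : map_mx (horner_eval s) (lift A) = A.
    by apply/matrixP => p q; rewrite !mxE /horner_eval hornerC.
  have DE : map_mx (horner_eval s) D = s *: delta_mx j i.
    by rewrite map_mxZ map_delta_mx /= /horner_eval hornerX.
  rewrite /L conjmx_by_mul ?unitmx_mul ?ub ?uu ?elem_unit //.
  rewrite conjmx_by_mul ?unitmx_mul ?ub ?uu ?elem_unit //.
  rewrite /P !map_mxM map_mxB map_mxD !liftE DE map_mx1 -/(elem j i s) -scaleNr.
  by rewrite -/(elem j i (- s)) -elem_inv // [in RHS]/conjmx_by !mulmxA.
suff -> : b *m wdot K u *m c = L 0 by rewrite -PE; apply: closed_curve => // s /FL; rewrite PE.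
by rewrite /L /elem scale0r addr0 mulmx1.
Qed.

Lemma BwB_orbit_bruhat (F : 'M[K]_n -> Prop) x u w : zariski_closed F -> bruhat u w ->
  (forall y, BwB_orbit x w y -> F y) -> forall y, BwB_orbit x u y -> F y.
Proof.
move=> clF /connectP[p]; elim: p u => [|v p IHp] u /=; first by move=> _ ->.
move=> /andP[uv vp] ew Fw; apply: BwB_orbit_step clF _ uv; exact: IHp ew Fw.
Qed.

End Degeneration.

(** * The stabilizer of $x_k$ and the reduction of $BwB$ to $B$-orbits *)

Section Stabilizer.
Local Open Scope ring_scope.
Variables (K : fieldType) (n k : nat) (hk : (2 * k <= n)%N).
Implicit Types (u w v : 'S_n) (b c d g x y : 'M[K]_n).

(** The subtraction is truncated: the value is meaningful only for $n-k\le j$, where it inverts the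
    shift by $n-k$. *)
Definition unshift (j : 'I_n) : 'I_n :=
  Ordinal (leq_ltn_trans (leq_subr (n - k) j) (ltn_ord j)).

Lemma mul_xk_r b i j :
  (b *m xk K n k) i j = if (n - k <= j)%N then b i (unshift j) else 0.
Proof.
rewrite mxE; case: ifP => kj; last by rewrite big1 // => r _; rewrite mxE kj mulr0.
rewrite (bigD1 (unshift j)) //= big1 ?addr0 => [|r nr]; rewrite mxE kj ?eqxx ?mulr1 //=.
by rewrite (_ : (_ == _) = false) ?mulr0 //; apply/negbTE; rewrite -val_eqE in nr.
Qed.

Lemma mul_xk_l b (i j r : 'I_n) : r = (n - k + i)%N :> nat -> (xk K n k *m b) i j = b r j.
Proof.
move=> er; rewrite mxE (bigD1 r) //= big1 ?addr0 => [|t nt]; rewrite mxE.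
  by rewrite er leq_addr addKn eqxx mul1r.
rewrite (_ : _ && _ = false) ?mul0r //; move: nt.
by rewrite -val_eqE /= er; lia.
Qed.

Lemma mul_xk_l0 b (i j : 'I_n) : (k <= i)%N -> (xk K n k *m b) i j = 0.
Proof.
move=> ki; rewrite mxE big1 // => t _; rewrite mxE.
by rewrite (_ : _ && _ = false) ?mul0r //; have := ltn_ord t; lia.
Qed.

Lemma Ck_wdot v : v \in WC n k -> conjmx_by (wdot K v) (xk K n k) = xk K n k.
Proof.
case/mem_WC => vL vC; apply: conjmx_byP; first exact: wdot_unit.
apply/matrixP => i j; rewrite mul_xk_r mul_wdot_r [RHS]mxE !mxE.
have := (WL_blocks j vL).2; case: (leqP (n - k) j) => kj; case: leqP => //= _ _.
by rewrite (vC (unshift j)) /= ?subnKC // ?addKn //; have := ltn_ord j; lia.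
Qed.

(* With b11 the top left k x k block of b, one has b x_k = x_k e for e the
   block diagonal matrix (1, 1, b11), and in the upper triangular e b^-1 only
   the last k rows matter on the right of x_k; d keeps just these. *)
Lemma Borel_conj_xk b : Borel b -> exists d, [/\ Borel d,
  forall i j, i != j -> d i j != 0 -> (n - k <= i)%N &
  conjmx_by b (xk K n k) = conjmx_by (invmx d) (xk K n k)].
Proof.
move=> Bb; have [ub _] := Bb; have [tb nzb] := (BorelP b).1 Bb.
pose e : 'M[K]_n := \matrix_(i, j)
  if (n - k <= i)%N && (n - k <= j)%N then b (unshift i) (unshift j) else (i == j)%:R.
have Be : Borel e.
  apply/BorelP; split=> [i j ji|i]; rewrite mxE.
    case: ifP => [/andP[ki kj]|_]; last by rewrite -val_eqE /= (gtn_eqF ji).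
    by apply: tb => /=; lia.
  by rewrite eqxx; case: ifP; rewrite ?oner_eq0.
have xe : b *m xk K n k = xk K n k *m e.
  apply/matrixP => i j; rewrite mul_xk_r; have [ki|ik] := leqP k i.
    by rewrite mul_xk_l0 //; case: ifP => // kj; apply: tb => /=; have := ltn_ord j; lia.
  have lt_r : (n - k + i < n)%N by lia.
  rewrite (@mul_xk_l e i j (Ordinal lt_r)) // mxE /= leq_addr /=.
  case: ifP => kj; first by congr (b _ _); apply: val_inj; rewrite /= addKn.
  by rewrite -val_eqE /= (_ : (_ == _) = false) //; lia.
pose h := e *m invmx b.
have Bh : Borel h by apply: BorelM Be (BorelV Bb).
have [th nzh] := (BorelP h).1 Bh.
pose d : 'M[K]_n := \matrix_(i, j) if (i < n - k)%N then (i == j)%:R else h i j.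
have Bd : Borel d.
  apply/BorelP; split=> [i j ji|i]; rewrite mxE; case: ifP => _ //.
  - by rewrite -val_eqE /= (gtn_eqF ji).
  - exact: th.
  - by rewrite eqxx oner_eq0.
have [ud td] := Bd.
exists d; split=> // [i j ij|].
  by rewrite mxE; case: ltnP => // _; rewrite (negPf ij) eqxx.
have dx : d *m xk K n k = xk K n k.
  apply/matrixP => i j; rewrite mul_xk_r [RHS]mxE; case: leqP => //= kj.
  have [ik|ki] := ltnP i (n - k); first by rewrite mxE ik -val_eqE.
  rewrite td /=; last by have := ltn_ord j; lia.
  by rewrite (_ : (_ == _) = false) //; have := ltn_ord j; lia.
have xd : xk K n k *m d = xk K n k *m h.
  apply/matrixP => i j; have [ki|ik] := leqP k i; first by rewrite !mul_xk_l0.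
  have lt_r : (n - k + i < n)%N by lia.
  by rewrite !(@mul_xk_l _ i j (Ordinal lt_r)) // mxE /= ltnNge leq_addr.
(* On one side $b x_k b^{-1}=x_k e b^{-1}=x_k h=x_k d$; on the other $d^{-1}x_k d=x_k d$, since $d$
   fixes the image of $x_k$. *)
transitivity (xk K n k *m d).
  by rewrite xd /conjmx_by xe mulmxA.
apply/esym/conjmx_byP; first by rewrite unitmx_inv.
by rewrite -mulmxA mulmxV // mulmx1 -{1}dx mulmxA mulVmx // mul1mx.
Qed.

(* The minimality of w on the last block makes w d w^-1 upper triangular. *)
Lemma BwB_orbit_Borel w y :
    (forall a b : 'I_n, (n - k <= a)%N -> (a < b)%N -> (w a < w b)%N) ->
  BwB_orbit (xk K n k) w y -> exists2 b, Borel b & y = conjmx_by b (arcmx K hk w).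
Proof.
move=> incw [b [c [Bb Bc ->]]]; have [d [Bd shape conj_d]] := Borel_conj_xk Bc.
have [[[ub _] [uc _]] [ud td]] := (Bb, Bc, Bd); have uw := wdot_unit K w.
pose D := wdot K w *m d *m invmx (wdot K w).
have DE i j : D (w i) (w j) = d i j.
  by rewrite -mul_wdot_r /D mulmxKV // mul_wdot_l.
have BD : Borel D.
  split=> [|i j]; first by rewrite !unitmx_mul uw ud unitmx_inv.
  rewrite -[i](permKV w) -[j](permKV w) DE => ji.
  set p := (w^-1 i)%g in ji *; set q := (w^-1 j)%g in ji *.
  have npq : p != q by apply: contraTneq ji => ->; rewrite ltnn.
  apply/eqP; apply: contraTT ji => nz; rewrite -leqNgt ltnW // incw //.
    exact: shape npq nz.
  rewrite ltn_neqAle val_eqE npq leqNgt; apply: contra nz => /td ->.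
  exact: eqxx.
have Dw : wdot K w *m invmx d = invmx D *m wdot K w.
  have [uD _] := BD; have wd : wdot K w *m d = D *m wdot K w by rewrite /D mulmxKV.
  by rewrite -[X in invmx D *m X](mulmxK ud) wd -(mulmxA D) mulKmx.
(* The factor $d^{-1}$, which replaces $c$ on $x_k$, moves to the left of $w$ as $D^{-1}$. *)
exists (b *m invmx D); first exact: BorelM Bb (BorelV BD).
have uDi : invmx D \in unitmx by rewrite unitmx_inv; case: BD.
rewrite conjmx_by_mul ?unitmx_mul ?ub // conj_d -conjmx_by_mul ?unitmx_mul ?unitmx_inv ?ub //.
by rewrite -(mulmxA b) Dw mulmxA conjmx_by_mul ?unitmx_mul ?ub // conjmx_by_wdot.
Qed.

Lemma BorbitP s a y : Borbit k s a y <->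
  exists2 b, Borel b & y = conjmx_by b (arcmx K hk (s \oS a)).
Proof.
split=> [[b [c [Bb [uc Cc] ->]]]|[b Bb ->]]; have [ub _] := Bb.
  exists b => //; rewrite -(mulmxA b) wdotM.
  rewrite conjmx_by_mul ?unitmx_mul ?ub ?wdot_unit // Cc.
  by rewrite conjmx_by_mul ?wdot_unit // conjmx_by_wdot.
exists b, 1%:M; split=> //; first by split; rewrite ?unitmx1 // /conjmx_by mul1mx invmx1 mulmx1.
by rewrite mulmx1 -(mulmxA b) wdotM conjmx_by_mul ?wdot_unit // conjmx_by_wdot.
Qed.

End Stabilizer.

Theorem corollary2p8 (K : closedFieldType) (charK0 : [pchar K]%R =i pred0)
    (n k : nat) (hk : 2 * k <= n)
    (sigma' alpha' sigma alpha : 'S_n)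
    (hsigma' : sigma' \in Zk n k) (halpha' : alpha' \in Wk n k)
    (hsigma : sigma \in Zk n k) (halpha : alpha \in Wk n k) :
  (forall u : 'M[K]_n,
     Zclosure k sigma' alpha' u -> Zclosure k sigma alpha u) <->
  (exists tau : 'S_n,
     bruhat tau (sigma \oS alpha) /\
     pcoset (sigma' \oS alpha') (WC n k) = pcoset tau (WC n k)).
Proof.
(* Beyond position $k$ the element of $W_k$ acts trivially, so only the monotonicity of the element
   of $Z_k$ is involved. *)
have incr s a lo hi : s \in Zk n k -> a \in Wk n k -> (k <= lo)%N ->
    (forall j, lo < j < hi -> (j != k) && (j != n - k))%N ->
    forall p q : 'I_n, (lo <= p)%N -> (p < q)%N -> (q < hi)%N ->
    ((s \oS a) p < (s \oS a) q)%N.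
  move=> sZ aW klo nb p q lop pq qhi.
  rewrite !pcompE !(Wk_fix aW) ?(leq_trans klo) ?(leq_trans lop (ltnW pq)) //.
  exact: Zk_increasing sZ nb _ _ lop pq qhi.
set w' := sigma' \oS alpha'; set w := sigma \oS alpha.
have incw (a b : 'I_n) : (n - k <= a)%N -> (a < b)%N -> (w a < w b)%N.
  move=> ka ab; apply: (@incr _ _ (n - k) n) => //; first lia.
  by move=> j; lia.
split=> [sub|[tau [le_tw /pcoset_eqP[v vC etau]]] y [Oy cly]].
  (* The point $N_{w'}$ lies in the smaller closure, taking $b=1$, hence in the larger one. *)
  have clos F : zariski_closed F ->
      (forall b, Borel b -> F (conjmx_by b (arcmx K hk w))) -> F (arcmx K hk w').
    move=> clF FB; have [|_] := sub (arcmx K hk w'); last first.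
      by apply=> // y /(BorbitP hk)[b Bb ->]; apply: FB.
    split=> [|G _ GB]; first exact: Ok_arcmx.
    apply: GB; apply/(BorbitP hk); exists 1%:M%R; first exact: Borel1.
    by rewrite /conjmx_by mul1mx invmx1 mulmx1.
  have [|v vC le_vw] := exists_WC_bruhat hk _ incw (arc_rank_closure clos).
    move=> a b ka ab bk; apply: (@incr _ _ k (n - k)%N) => //; first lia.
  by exists (w' \oS v); split=> //; apply/pcoset_eqP; exists v.
split=> // F clF FB; apply: cly => // z /(BorbitP hk)[b Bb ->].
(* As $F$ contains the orbit of $N_w$, it contains $BwB.x_k$ and then, by degeneration, $B\tau
   B.x_k$. The latter contains the orbit of $N_{w'}$, because $\tau=w'v$ with $v$ stabilizing
   $x_k$. *)
apply: (BwB_orbit_bruhat (x := xk K n k) clF le_tw) => [t|].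
  by case/(BwB_orbit_Borel hk incw) => c Bc ->; apply/FB/(BorbitP hk); exists c.
exists b, 1%:M%R; split; rewrite ?mulmx1 //; first exact: Borel1.
have [ub _] := Bb; rewrite etau -wdotM.
rewrite conjmx_by_mul ?unitmx_mul ?wdot_unit // conjmx_by_mul ?wdot_unit //.
by rewrite Ck_wdot // conjmx_by_wdot.
Qed.
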